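(* Let $(x,y,a,b)$ be local coordinates on $M^4$ where $(x,y)$ are the Cartesian coordinates (in an affine chart of $\mathbb{RP}^2$) of the point $q$ and $(a,b)$ are the coordinates of the line $p$ with equation $y=ax+b$. In these coordinates the dancing metric $\mathbf g$ on $M^4$ is given, up to conformal equivalence, by $$\mathbf g\sim da\,[(y-b)\,dx-x\,dy]+db\,[a\,dx-dy],$$ where $\sim$ denotes equality up to multiplication by some non-vanishing function.
   Context: $M^4\subset\mathbb{RP}^2\times\mathbb{RP}^{2*}$ is the set of non-incident point–line pairs $(q,p)=([\mathbf q],[\mathbf p])$ with $\mathbf q\in\mathbb R^3$ (columns), $\mathbf p\in(\mathbb R^3)^*$ (rows), $\mathbf p\mathbf q\neq0$; $[\mathbf p]$ represents the line $\{[\mathbf q]:\mathbf p\mathbf q=0\}$. Let $Q^5=\{\mathbf p\mathbf q=1\}\subset\mathbb R^3\oplus(\mathbb R^3)^*$ carry the restriction of the flat metric $-2\,d\mathbf p\,d\mathbf q$. The dancing metric $\mathbf g$ is the unique pseudo-riemannian metric on $M^4$ (signature $(2,2)$) for which $Q^5\to M^4$, $(\mathbf q,\mathbf p)\mapsto([\mathbf q],[\mathbf p])$, is a pseudo-riemannian submersion. Products of 1-forms are symmetric products. *)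

(* Defs.v *)
From HB Require Import structures.
From mathcomp Require Import all_boot all_order all_algebra.
From mathcomp Require Import all_classical all_reals all_analysis.
From mathcomp Require Import ring.
Import Order.TTheory GRing.Theory Num.Theory.
Import numFieldNormedType.Exports.

Set Implicit Arguments.
Unset Strict Implicit.
Unset Printing Implicit Defensive.

Local Open Scope classical_set_scope.
Local Open Scope ring_scope.

Section Smooth.
Variables (R : realType) (V : normedModType R).

(* For finite-dimensional V and open U this is the usual C^k condition, phrased
   with all directional derivatives instead of partial derivatives. *)
Fixpoint Ck_on (k : nat) (U : set V) (f : V -> R) : Prop :=
  match k with
  | 0 => forall c, U c -> {for c, continuous f}
  | k'.+1 => (forall c, U c -> differentiable f c) /\
             forall v : V, Ck_on k' U ('D_v f)
  end.

Definition smooth_on (U : set V) (f : V -> R) : Prop := forall k, Ck_on k U f.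

End Smooth.

Section SymmetricProduct.
Variables (R : realType) (V : Type).

Definition symprod (al be : V -> R) (u v : V) : R :=
  (al u * be v + al v * be u) / 2.

End SymmetricProduct.

Section Dancing.
Variable R : realType.

Local Notation flat6 := ('cV[R]_3 * 'rV[R]_3)%type.

Definition pairing (z : flat6) : R := (z.2 *m z.1) 0 0.

(* -2 dp dq = -2 \sum_i dp_i dq^i as a symmetric bilinear form on each tangent
   space of R^3 (+) (R^3)^* . *)
Definition flat_metric (u v : flat6) : R :=
  - 2 * \sum_(i < 3) symprod (fun w : flat6 => w.2 0 i)
                             (fun w : flat6 => w.1 i 0) u v.

Definition Q5 : set flat6 := [set z | pairing z = 1].

Definition tangentQ (z : flat6) : set flat6 := [set v | 'd pairing z v = 0].

(* Points of RP^2 (resp. RP^{2*}) are the lines <[q]> (resp. <[p]>) through the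
   origin of R^3 (resp. of its dual). *)
Definition RP2xRP2d : Type := ({vspace 'cV[R]_3} * {vspace 'rV[R]_3})%type.

Definition proj (z : flat6) : RP2xRP2d := (<[z.1]>%VS, <[z.2]>%VS).

Definition M4 : set RP2xRP2d :=
  [set m | exists2 z, pairing z != 0 & m = proj z].

(* An affine chart of RP^2 with Cartesian coordinates (s, t) is
   (s, t) |-> [A (s, t, 1)^T] for an invertible A; the coordinate vector of a
   point-line pair is (x, y, a, b). *)
Definition hom_pt (s t : R) : 'cV[R]_3 := \col_(i < 3) [:: s; t; 1]`_i.
Definition hom_line (a b : R) : 'rV[R]_3 := \row_(i < 3) [:: a; -1; b]`_i.

Definition xc (c : 'rV[R]_4) : R := c 0 0.
Definition yc (c : 'rV[R]_4) : R := c 0 1.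
Definition ac (c : 'rV[R]_4) : R := c 0 2.
Definition bc (c : 'rV[R]_4) : R := c 0 3.

Definition param_lift (A : 'M[R]_3) (c : 'rV[R]_4) : flat6 :=
  (A *m hom_pt (xc c) (yc c), hom_line (ac c) (bc c) *m invmx A).

Definition param (A : 'M[R]_3) (c : 'rV[R]_4) : RP2xRP2d :=
  proj (param_lift A c).

(* The point is not at infinity and the line is neither vertical nor at
   infinity, in the affine chart A. *)
Definition in_chart (A : 'M[R]_3) (z : flat6) : Prop :=
  (invmx A *m z.1) 2 0 != 0 /\ (z.2 *m A) 0 1 != 0.

Definition coords (A : 'M[R]_3) (z : flat6) : 'rV[R]_4 :=
  let q := invmx A *m z.1 in
  let p := z.2 *m A in
  \row_(i < 4) [:: q 0 0 / q 2 0; q 1 0 / q 2 0;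
                   - (p 0 0 / p 0 1); - (p 0 2 / p 0 1)]`_i.

Definition chart_dom (A : 'M[R]_3) : set 'rV[R]_4 := [set c | M4 (param A c)].

Lemma coords_param_lift (A : 'M[R]_3) (c : 'rV[R]_4) :
  A \in unitmx -> coords A (param_lift A c) = c.
Proof.
move=> uA; apply/rowP => i; rewrite /coords /param_lift /= mulKmx // mulmxKV // !mxE /=.
by case: i => [[|[|[|[|//]]]] hi] /=;
  rewrite ?divr1 ?invrN ?invr1 ?mulrN ?mulr1 ?opprK;
  congr (c _ _); apply/val_inj.
Qed.

Lemma line_equation (A : 'M[R]_3) (z : flat6) (s t : R) : in_chart A z ->
  pairing (A *m hom_pt s t, z.2) = 0 <->
  t = ac (coords A z) * s + bc (coords A z).
Proof.
rewrite /in_chart /pairing /ac /bc /coords /= mulmxA.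
move: (z.2 *m A) => p [_ p1].
rewrite !mxE /= !big_ord_recl big_ord0 !mxE /=.
have -> : lift ord0 ord0 = 1 :> 'I_3 by apply/val_inj.
have -> : lift ord0 (lift ord0 ord0) = 2 :> 'I_3 by apply/val_inj.
rewrite mulr1 addr0; split=> [h|->]; last by field.
apply: (mulfI p1); transitivity (- (p 0 0 * s + p 0 2)); last by field.
by apply/eqP; rewrite -addr_eq0 -h; apply/eqP; ring.
Qed.

(* A tensor on M4 is given by its components: g A m is the Gram matrix of the
   form on T_m M4, in the coordinate frame of the chart A.  The charts of all
   A \in unitmx form an atlas of M4; components are only meaningful when m lies
   in the chart. *)
Definition tensor2 : Type := 'M[R]_3 -> RP2xRP2d -> 'M[R]_4.

Definition comp_form (g : tensor2) A m (u v : 'rV[R]_4) : R :=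
  (u *m g A m *m v^T) 0 0.

Definition pseudo_riemannian_metric (g : tensor2) : Prop :=
  [/\ forall A, A \in unitmx -> forall i j,
        smooth_on (chart_dom A) (fun c => g A (param A c) i j),
      forall A c, A \in unitmx -> chart_dom A c ->
        (g A (param A c))^T = g A (param A c),
      forall A c, A \in unitmx -> chart_dom A c ->
        g A (param A c) \in unitmx
    & forall A B c, A \in unitmx -> B \in unitmx ->
        chart_dom A c -> in_chart B (param_lift A c) ->
        let tau := coords B \o param_lift A in
        forall u v, comp_form g A (param A c) u v =
                    comp_form g B (param A c) ('d tau c u) ('d tau c v)].

(* 'd (coords A) z, restricted to T_z Q5, is the differential of the projection
   Q5 -> M4 read in the chart A; flat_metric is only used on T_z Q5. *)
Definition vertical (A : 'M[R]_3) (z : flat6) : set flat6 :=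
  [set v | tangentQ z v /\ 'd (coords A) z v = 0].

Definition horizontal (A : 'M[R]_3) (z : flat6) : set flat6 :=
  [set u | tangentQ z u /\ forall v, vertical A z v -> flat_metric u v = 0].

Definition proj_pseudo_riemannian_submersion (g : tensor2) : Prop :=
  forall A z, A \in unitmx -> Q5 z -> in_chart A z ->
    [/\ forall w, exists2 v, tangentQ z v & 'd (coords A) z v = w,
        forall v, vertical A z v -> horizontal A z v -> v = 0
      & forall u v, horizontal A z u -> horizontal A z v ->
          comp_form g A (proj z) ('d (coords A) z u) ('d (coords A) z v) =
          flat_metric u v].

Definition dancing_metric (g : tensor2) : Prop :=
  pseudo_riemannian_metric g /\ proj_pseudo_riemannian_submersion g.

End Dancing.

(* Main.v *)
(* At a point (q, p) of Q^5 the fibre direction is (q, -p), so a tangent vector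
   (dq, dp) is horizontal iff p dq = dp q = 0.  Lifting coordinate vectors of the
   chart to such horizontal vectors over q = (x, y, 1), p = (a, -1, b) / D with
   D = a x - y + b turns -2 dp dq into (2 / D^2) times the model form.  The factor
   2 / D^2 is smooth because, up to the constant -2, it is the db dy entry of the
   (smooth) Gram matrix. *)
Require Import Defs.
From HB Require Import structures.
From mathcomp Require Import all_boot all_order all_algebra.
From mathcomp Require Import all_classical all_reals all_analysis.
From mathcomp Require Import ring.
Import Order.TTheory GRing.Theory Num.Theory.
Import numFieldNormedType.Exports.

Set Implicit Arguments.
Unset Strict Implicit.
Unset Printing Implicit Defensive.

Local Open Scope classical_set_scope.
Local Open Scope ring_scope.

(** * Locality of differentiability and of the C^k condition *)

Lemma near_eq_differentiable (R : numFieldType) (V W : normedModType R)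
    (f g : V -> W) (x : V) :
  {near x, f =1 g} -> differentiable f x -> differentiable g x.
Proof.
move=> fg df; have [dfc dfx] := (diff_locallyP x f).1 df.
(* A little-o remainder depends only on the germ at [0], so the first-order expansion of [f] serves
   for [g] with the same linear part. *)
have gx : g \o shift x = cst (g x) + 'd f x +o_ 0 id.
  rewrite -(nbhs_singleton fg); apply/eqaddoP => e e0.
  have := (eqaddoP _ _ _ _).1 dfx e e0.
  have : \forall y \near 0, f (y + x) = g (y + x).
    by move: fg; rewrite (near_shift 0) subr0.
  by apply: filterS2 => y /= fgy; rewrite !fctE /= fgy.
by apply/(diff_locallyP x g).2; rewrite (diff_unique dfc gx); split.
Qed.

Section CkOn.
Variables (R : realType) (V : normedModType R).
Implicit Types (U : set V) (f g : V -> R).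

(** Openness of [U] turns equality on [U] into equality near each of its points, so directional
    derivatives also agree on [U] and the induction applies to them. *)
Lemma Ck_on_congr k U f g :
  open U -> (forall c, U c -> f c = g c) -> Ck_on k U f -> Ck_on k U g.
Proof.
move=> oU; elim: k f g => [|k IH] f g fg.
  move=> fc c Uc; have fgc : {near c, f =1 g}.
    by apply: filterS (open_nbhs_nbhs (conj oU Uc)) => ?; apply: fg.
  move: (fc c Uc); rewrite /prop_for /continuous_at fg //.
  by apply: cvg_trans; apply: near_eq_cvg; apply: filterS fgc => y ->.
have fgc c : U c -> {near c, f =1 g}.
  by move=> Uc; apply: filterS (open_nbhs_nbhs (conj oU Uc)) => ?; apply: fg.
move=> [df Df]; split=> [c Uc|v].
  exact: near_eq_differentiable (fgc c Uc) (df c Uc).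
by apply: IH (Df v) => c Uc; apply: near_eq_derive (fgc c Uc).
Qed.

Lemma Ck_onZ k U f (r : R) : open U -> Ck_on k U f -> Ck_on k U (r *: f).
Proof.
move=> oU; elim: k f => [|k IH] f.
  by move=> fc c Uc; exact: continuousZl_tmp (fc c Uc).
move=> [df Df]; split=> [c Uc|v]; first exact: differentiableZ (df c Uc).
(* ['D_v (r *: f)] is compared with [r *: 'D_v f] only on [U], where [f] is differentiable. *)
apply: Ck_on_congr oU _ (IH _ (Df v)) => c Uc.
by rewrite deriveZ //; apply/diff_derivable/df.
Qed.

End CkOn.

(** * Differentials of linear, matrix-valued and quotient maps *)

Section Differentials.
Variables (R : realType) (V : normedModType R).

Lemma is_diff_linear (W : normedModType R) (f : V -> W) (x : V) :
  linear f -> continuous f -> is_diff x f f.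
Proof.
move=> lf cf; pose fM := GRing.isLinear.Build _ _ _ _ _ lf.
pose fL : {linear V -> W} := HB.pack f fM.
rewrite -[f]/(fL : _ -> _); apply: DiffDef; first exact: linear_differentiable.
by rewrite diff_lin.
Qed.

Lemma is_diff_sum (W : normedModType R) n (f df : 'I_n -> V -> W) (x : V) :
  (forall i, is_diff x (f i) (df i)) ->
  is_diff x (fun t => \sum_(i < n) f i t) (fun v => \sum_(i < n) df i v).
Proof.
move=> h; rewrite -!fct_sumE.
elim/big_ind2: _ => [|? ? ? ? ? ?|i _]; [exact: is_diff_cst|exact: is_diffD|exact: h].
Qed.

Lemma is_diff_mx m n (M : V -> 'M[R]_(m, n)) (dM : 'I_m -> 'I_n -> V -> R) x :
  (forall i j, is_diff x (fun t => M t i j) (dM i j)) ->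
  is_diff x M (fun v => \matrix_(i, j) dM i j v).
Proof.
move=> h.
have dM' : differentiable M x.
  (* A sum of scalar functions times constant matrices is differentiable; the value of its
     differential is then read off entrywise from directional derivatives. *)
  have -> : M = \sum_(i < m) \sum_(j < n) (fun t => M t i j *: delta_mx i j).
    apply/funext => t; rewrite fct_sumE {1}[M t]matrix_sum_delta.
    by apply: eq_bigr => i _; rewrite fct_sumE.
  do 2![apply: differentiable_sum => ?].
  by apply: differentiableZl; exact: ex_diff.
split=> //; apply/funext => v.
rewrite -deriveE // derive_mx; last exact: diff_derivable.
apply/matrixP => i j; rewrite !mxE deriveE; last exact: ex_diff.
by rewrite diff_val.
Qed.

Lemma is_diff_ratio (f g df dg : V -> R) (x : V) :
  is_diff x f df -> is_diff x g dg -> g x != 0 ->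
  is_diff x (fun t => f t / g t) (fun v => (df v * g x - f x * dg v) / g x ^+ 2).
Proof.
move=> hf hg g0.
have hV : is_diff x (fun t => (g t)^-1) (fun v => - (g x) ^- 2 * dg v).
  apply: DiffDef; first by apply: differentiableV => //; exact: ex_diff.
  by rewrite diffV // ?diff_val //; exact: ex_diff.
have h := is_diffM hf hV.
by apply: (is_diff_eq h); apply/funext => v; rewrite !fctE /GRing.scale /=; field.
Qed.

End Differentials.

(** * Differentials of coordinates and of the pairing on the flat space *)

Section FlatDifferentials.
Variable R : realType.
Local Notation flat6 := ('cV[R]_3 * 'rV[R]_3)%type.
Implicit Type z : flat6.

Lemma is_diff_pt_coord z i : is_diff z (fun t : flat6 => t.1 i 0) (fun v => v.1 i 0).
Proof.
apply: is_diff_linear => [k u v|t]; first by rewrite !mxE.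
by apply: (@continuous_comp _ _ _ fst (fun N : 'cV[R]_3 => N i 0));
  [exact: cvg_fst | exact: coord_continuous].
Qed.

Lemma is_diff_line_coord z i : is_diff z (fun t : flat6 => t.2 0 i) (fun v => v.2 0 i).
Proof.
apply: is_diff_linear => [k u v|t]; first by rewrite !mxE.
by apply: (@continuous_comp _ _ _ snd (fun N : 'rV[R]_3 => N 0 i));
  [exact: cvg_snd | exact: coord_continuous].
Qed.

Lemma is_diff_pt_form (B : 'M[R]_3) z i :
  is_diff z (fun t : flat6 => (B *m t.1) i 0) (fun v => (B *m v.1) i 0).
Proof.
have e : (fun t : flat6 => (B *m t.1) i 0) = (fun t => \sum_j (B i j *: t.1 j 0)).
  by apply/funext => t; rewrite mxE.
rewrite e; apply: is_diff_sum => j; apply: is_diffZ; exact: is_diff_pt_coord.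
Qed.

Lemma is_diff_line_form (B : 'M[R]_3) z i :
  is_diff z (fun t : flat6 => (t.2 *m B) 0 i) (fun v => (v.2 *m B) 0 i).
Proof.
have e : (fun t : flat6 => (t.2 *m B) 0 i) = (fun t => \sum_j (B j i *: t.2 0 j)).
  by apply/funext => t; rewrite mxE; apply: eq_bigr => j _; rewrite mulrC.
rewrite e; apply: is_diff_sum => j; apply: is_diffZ; exact: is_diff_line_coord.
Qed.

Lemma diff_pairing z v : 'd (@pairing R) z v = (z.2 *m v.1) 0 0 + (v.2 *m z.1) 0 0.
Proof.
have e : @pairing R =
    (fun t => \sum_j ((fun t : flat6 => t.2 0 j) * (fun t : flat6 => t.1 j 0)) t).
  by apply/funext => t; rewrite /pairing mxE.
have d : is_diff z (@pairing R)
    (fun v => \sum_j (z.2 0 j *: (fun v : flat6 => v.1 j 0)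
                      + z.1 j 0 *: (fun v : flat6 => v.2 0 j)) v).
  rewrite e; apply: is_diff_sum => j; apply: is_diffM.
    exact: is_diff_line_coord.
  exact: is_diff_pt_coord.
rewrite diff_val !mxE -big_split /=; apply: eq_bigr => j _.
by congr (_ + _); apply: mulrC.
Qed.

End FlatDifferentials.

(** * Coordinate formulas, the chart domain and lifts to the quadric *)

Section Dancing.
Variable R : realType.
Local Notation flat6 := ('cV[R]_3 * 'rV[R]_3)%type.
Implicit Types (A : 'M[R]_3) (z u v : flat6) (c w : 'rV[R]_4).

Lemma mul_row3_col3 (p : 'rV[R]_3) (q : 'cV[R]_3) :
  (p *m q) 0 0 = p 0 0 * q 0 0 + p 0 1 * q 1 0 + p 0 2 * q 2 0.
Proof.
rewrite mxE !big_ord_recl big_ord0 addr0 addrA.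
by congr (_ + _ * _ + _ * _); congr (_ _ _); apply/val_inj.
Qed.

Lemma ord4P (P : 'I_4 -> Prop) : P 0 -> P 1 -> P 2 -> P 3 -> forall i, P i.
Proof.
move=> P0 P1 P2 P3 [[|[|[|[|//]]]] hi].
- by rewrite (_ : Ordinal hi = 0) //; apply/val_inj.
- by rewrite (_ : Ordinal hi = 1) //; apply/val_inj.
- by rewrite (_ : Ordinal hi = 2) //; apply/val_inj.
- by rewrite (_ : Ordinal hi = 3) //; apply/val_inj.
Qed.

Lemma ord3P (P : 'I_3 -> Prop) : P 0 -> P 1 -> P 2 -> forall i, P i.
Proof.
move=> P0 P1 P2 [[|[|[|//]]] hi].
- by rewrite (_ : Ordinal hi = 0) //; apply/val_inj.
- by rewrite (_ : Ordinal hi = 1) //; apply/val_inj.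
- by rewrite (_ : Ordinal hi = 2) //; apply/val_inj.
Qed.

Lemma flat_metricE u v :
  flat_metric u v = - ((u.2 *m v.1) 0 0 + (v.2 *m u.1) 0 0).
Proof.
rewrite /flat_metric /symprod !mxE -big_split /= mulNr mulr_sumr.
by congr (- _); apply: eq_bigr => i _; field.
Qed.

Lemma pairing_frame A z : A \in unitmx ->
  pairing z = (z.2 *m A *m (invmx A *m z.1)) 0 0.
Proof. by move=> uA; rewrite mulmxA mulmxK. Qed.

Lemma is_diff_coords A z : in_chart A z ->
  is_diff z (coords A) (fun v =>
    let q := invmx A *m z.1 in let p := z.2 *m A in
    let dq := invmx A *m v.1 in let dp := v.2 *m A in
    \row_(i < 4) [:: (dq 0 0 * q 2 0 - q 0 0 * dq 2 0) / q 2 0 ^+ 2;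
                     (dq 1 0 * q 2 0 - q 1 0 * dq 2 0) / q 2 0 ^+ 2;
                     - ((dp 0 0 * p 0 1 - p 0 0 * dp 0 1) / p 0 1 ^+ 2);
                     - ((dp 0 2 * p 0 1 - p 0 2 * dp 0 1) / p 0 1 ^+ 2)]`_i).
Proof.
move=> [q2 p1]; apply: is_diff_mx => i j.
rewrite /coords; under eq_fun do rewrite mxE.
have Q k := @is_diff_pt_form R (invmx A) z k.
have P k := @is_diff_line_form R A z k.
elim/ord4P: j => /=; last 2 first.
- exact: is_diffN (is_diff_ratio (P 0) (P 1) p1).
- exact: is_diffN (is_diff_ratio (P 2) (P 1) p1).
- exact: is_diff_ratio (Q 0) (Q 2) q2.
- exact: is_diff_ratio (Q 1) (Q 2) q2.
Qed.

(** This is [D]; it vanishes exactly when the point [(x, y)] lies on the line [y = a x + b]. *)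
Definition incidence c : R := ac c * xc c - yc c + bc c.

Lemma pairing_param_lift A c : A \in unitmx ->
  pairing (param_lift A c) = incidence c.
Proof.
move=> uA; rewrite (pairing_frame _ uA) /= mulKmx // mulmxKV // mul_row3_col3 !mxE /=.
by rewrite /incidence; ring.
Qed.

(** [M4] only asks for some representative with nonzero pairing. Both vectors of such a
    representative are multiples of those of [param_lift A c], so the pairing of the latter cannot
    vanish either. *)
Lemma chart_domE A c : A \in unitmx -> chart_dom A c <-> incidence c != 0.
Proof.
move=> uA; rewrite -(pairing_param_lift c uA); split; last by exists (param_lift A c).
case=> z z0 e.
have /vlineP[s es] : z.1 \in <[(param_lift A c).1]>%VS.
  by have /= -> := congr1 fst e; exact: memv_line.
have /vlineP[t et] : z.2 \in <[(param_lift A c).2]>%VS.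
  by have /= -> := congr1 snd e; exact: memv_line.
move: z0; rewrite {1}/pairing es et -scalemxAl -scalemxAr 2!mxE.
by rewrite !mulf_eq0 !negb_or => /and3P[].
Qed.

Lemma incidence_continuous : continuous incidence.
Proof.
move=> c; have K i : {for c, continuous (fun c : 'rV[R]_4 => c 0 i)}.
  exact: coord_continuous.
exact: continuousD (continuousB (continuousM (K 2) (K 0)) (K 1)) (K 3).
Qed.

Lemma open_chart_dom A : A \in unitmx -> open (chart_dom A).
Proof.
move=> uA; have -> : chart_dom A = incidence @^-1` [set t | t != 0].
  by apply/seteqP; split=> c /(chart_domE _ uA).
by move/continuousP: incidence_continuous; apply; exact: open_neq.
Qed.

(** Only the covector is divided by [D]: the pairing becomes 1, while the point keeps its
    representative [(x, y, 1)] in the frame [A]. *)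
Definition Qpoint A c : flat6 :=
  ((param_lift A c).1, (incidence c)^-1 *: (param_lift A c).2).

(* al and be subtract from the naive lift its components along the fibre
   directions, so that p dq = 0 and dp q = 0. *)
Definition hlift A c w : flat6 :=
  let al := (ac c * xc w - yc w) / incidence c in
  let be := (ac w * xc c + bc w) / incidence c in
  (A *m \col_(i < 3) [:: xc w - al * xc c; yc w - al * yc c; - al]`_i,
   (incidence c)^-1 *:
     (\row_(i < 3) [:: ac w - be * ac c; be; bc w - be * bc c]`_i) *m invmx A).

Lemma proj_Qpoint A c : incidence c != 0 -> Defs.proj (Qpoint A c) = param A c.
Proof.
move=> D0; congr (_, _); apply/vspaceP => v; apply/vlineP/vlineP => -[k ->].
  by exists (k / incidence c); rewrite scalerA.
by exists (k * incidence c); rewrite scalerA mulfK.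
Qed.

Lemma Qpoint_Q5 A c : A \in unitmx -> incidence c != 0 -> Q5 (Qpoint A c).
Proof.
move=> uA D0; rewrite /Q5 /= /pairing -scalemxAl mxE.
by rewrite -[(_ *m _) 0 0]/(pairing (param_lift A c)) pairing_param_lift // mulVf.
Qed.

(** * Horizontal lifts over a fixed non-incident pair *)

Section Frame.
Variables (A : 'M[R]_3) (c : 'rV[R]_4).
Hypotheses (uA : A \in unitmx) (D0 : incidence c != 0).

Lemma in_chart_Qpoint : in_chart A (Qpoint A c).
Proof.
rewrite /in_chart /= mulKmx // -scalemxAl mulmxKV // !mxE /= oner_neq0; split=> //.
by rewrite mulf_neq0 ?invr_eq0 // oppr_eq0 oner_neq0.
Qed.

(** In the frame [A] the denominators of the chart are 1 for the point and [- 1 / D] for the line,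
    which simplifies the quotient rule and produces the factors [D]. *)
Lemma diff_coords_Qpoint v :
  'd (coords A) (Qpoint A c) v =
    let dq := invmx A *m v.1 in let dp := v.2 *m A in
    \row_(i < 4) [:: dq 0 0 - xc c * dq 2 0; dq 1 0 - yc c * dq 2 0;
                     incidence c * (dp 0 0 + ac c * dp 0 1);
                     incidence c * (dp 0 2 + bc c * dp 0 1)]`_i.
Proof.
have h := is_diff_coords in_chart_Qpoint; rewrite diff_val /=.
rewrite mulKmx // -scalemxAl mulmxKV //.
by apply/rowP; elim/ord4P; rewrite !mxE /=; field.
Qed.

Lemma pairing_pt_hlift w : ((Qpoint A c).2 *m (hlift A c w).1) 0 0 = 0.
Proof.
rewrite /= scalemxAl mulmxA mulmxKV // mul_row3_col3 !mxE /=.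
by rewrite /incidence; field.
Qed.

Lemma pairing_hlift_line w : ((hlift A c w).2 *m (Qpoint A c).1) 0 0 = 0.
Proof.
rewrite /= mulmxA mulmxKV // mul_row3_col3 !mxE /=.
by rewrite /incidence; field.
Qed.

(** The [al] and [be] corrections rescale the two representatives, so the differential of the chart
    kills them; the naive lift is sent to [w]. *)
Lemma diff_coords_hlift w : 'd (coords A) (Qpoint A c) (hlift A c w) = w.
Proof.
rewrite diff_coords_Qpoint /= mulKmx // mulmxKV //.
by apply/rowP; elim/ord4P; rewrite !mxE /= /xc /yc /ac /bc; field.
Qed.

(** The differential of the chart kills only separate rescalings of the two representatives. This
    form is enough to test orthogonality against [hlift]. *)
Lemma vertical_Qpoint v : vertical A (Qpoint A c) v ->
  exists s t, v = (s *: (Qpoint A c).1, t *: (Qpoint A c).2).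
Proof.
case=> _; rewrite diff_coords_Qpoint /=.
move eE: (invmx A *m v.1) => e; move pE: (v.2 *m A) => p /rowP h.
have := h 0; have := h 1; have := h 2; have := h 3; rewrite !mxE /= => h3 h2 h1 h0.
have {}h0 := subr0_eq h0; have {}h1 := subr0_eq h1.
have {}h2 : p 0 0 = - (ac c * p 0 1).
  by apply/eqP; rewrite -addr_eq0; move/eqP: h2; rewrite mulf_eq0 (negPf D0).
have {}h3 : p 0 2 = - (bc c * p 0 1).
  by apply/eqP; rewrite -addr_eq0; move/eqP: h3; rewrite mulf_eq0 (negPf D0).
(* Now [e] is proportional to [(x, y, 1)] and [p] to [(a, -1, b) / D]; the ratios are read off at
   the entries [1] and [- 1 / D]. *)
exists (e 2 0), (- incidence c * p 0 1); rewrite [v]surjective_pairing; congr (_, _).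
  rewrite /= -[v.1](mulKVmx uA) eE scalemxAr; congr (_ *m _).
  by apply/colP; elim/ord3P; rewrite !mxE /= ?h0 ?h1; ring.
rewrite /= -[v.2](mulmxK uA) pE !scalemxAl; congr (_ *m _).
by apply/rowP; elim/ord3P; rewrite !mxE /= ?h2 ?h3; field.
Qed.

(** The equations [p dq = 0] and [dp q = 0] give tangency to [Q5] by the Leibniz rule, and
    orthogonality to every [(s q, t p)] because the flat metric pairs [dp] with [s q] and [t p] with
    [dq]. *)
Lemma horizontal_hlift w : horizontal A (Qpoint A c) (hlift A c w).
Proof.
have := pairing_hlift_line w; have := pairing_pt_hlift w; have V := vertical_Qpoint.
move: (hlift A c w) (Qpoint A c) V => l z V zl lz; split=> [|v /V[s [t ->]]].
  by rewrite /tangentQ /= diff_pairing zl lz addr0.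
by rewrite flat_metricE /= -scalemxAl -scalemxAr mxE lz mxE zl !mulr0 addr0 oppr0.
Qed.

(** Before symmetrisation, [dp dq = (da dx - D al be) / D], that is [(D da dx - (x da + db) (a dx -
    dy)) / D ^+ 2]. The terms [a x da dx] cancel and minus the model form remains in the
    numerator. *)
Lemma flat_metric_hlift w1 w2 :
  flat_metric (hlift A c w1) (hlift A c w2) = 2 / incidence c ^+ 2 *
    (symprod (@ac R) (fun w => (yc c - bc c) * xc w - xc c * yc w) w1 w2
     + symprod (@bc R) (fun w => ac c * xc w - yc w) w1 w2).
Proof.
rewrite flat_metricE /= !mulmxA !mulmxKV // !mul_row3_col3 !mxE /=.
by rewrite /symprod /incidence; field.
Qed.

(** The lifts [hlift] are horizontal and project to arbitrary coordinate vectors, so the submersion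
    condition at the single point [Qpoint A c] determines [g] there. *)
Lemma comp_form_dancing (g : tensor2 R) w1 w2 : dancing_metric g ->
  comp_form g A (param A c) w1 w2 = 2 / incidence c ^+ 2 *
    (symprod (@ac R) (fun w => (yc c - bc c) * xc w - xc c * yc w) w1 w2
     + symprod (@bc R) (fun w => ac c * xc w - yc w) w1 w2).
Proof.
move=> [_ /(_ A (Qpoint A c) uA (Qpoint_Q5 uA D0) in_chart_Qpoint)[_ _ hor]].
rewrite -flat_metric_hlift -(hor _ _ (horizontal_hlift w1) (horizontal_hlift w2)).
by rewrite proj_Qpoint // !diff_coords_hlift.
Qed.

End Frame.

Lemma comp_form_delta (g : tensor2 R) A m i j :
  comp_form g A m (delta_mx 0 i) (delta_mx 0 j) = g A m i j.
Proof. by rewrite /comp_form -rowE trmx_delta -colE !mxE. Qed.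

End Dancing.

Theorem proposition5p3 (R : realType) (g : tensor2 R) (hg : dancing_metric g)
    (A : 'M[R]_3) (hA : A \in unitmx) :
  exists f : 'rV[R]_4 -> R,
    [/\ smooth_on (chart_dom A) f,
        forall c, chart_dom A c -> f c != 0
      & forall c, chart_dom A c ->
          let x := xc c in let y := yc c in
          let a := ac c in let b := bc c in
          let dx := @xc R in let dy := @yc R in
          let da := @ac R in let db := @bc R in
          forall u v : 'rV[R]_4,
            comp_form g A (param A c) u v =
            f c * (symprod da (fun w => (y - b) * dx w - x * dy w) u v
                   + symprod db (fun w => a * dx w - dy w) u v)].
Proof.
have [[smooth_g _ _ _] _] := hg.
(* The coefficient of db dy in the model form is the constant -1. *)
have fE c : chart_dom A c -> - 2 * g A (param A c) 3 1 = 2 / incidence c ^+ 2.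
  move=> /(chart_domE _ hA) D0.
  rewrite -comp_form_delta (comp_form_dancing hA D0 _ _ hg).
  by rewrite /symprod /xc /yc /ac /bc !mxE /=; field.
(* The symmetric product puts half of the coefficient [-1] in the entry [(3, 1)], whence the factor
   [- 2]. *)
exists ((- 2 : R) *: (fun c => g A (param A c) 3 1)); split=> [k|c cA|c cA /= u v].
- by apply: Ck_onZ (open_chart_dom hA) (smooth_g A hA 3 1 k).
- rewrite [_ c](fE c cA) mulf_neq0 ?pnatr_eq0 // invr_eq0 expf_eq0 /=.
  exact/(chart_domE _ hA).
- rewrite [X in _ = X * _](fE c cA).
  by apply: comp_form_dancing => //; exact/(chart_domE _ hA).
Qed.
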